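(* Consider the weighted graph on $V=\mathbb Z$ with $x\sim y$ if and only if $|x-y|=1$, vertex weights $\mu_x=1$ for all $x\in\mathbb Z$, and edge weights $\omega_{xy}=1$ for all $x\sim y$. Let $0<T<\infty$. For any $\epsilon>0$ there exist a constant $R_0=R_0(\epsilon)>0$, a constant $A>0$, and an ancient solution $u$ of the heat equation on $\mathbb Z\times[-T,0]$ such that $$|u(x,t)|\leq A e^{(1+\epsilon)x\ln x}\qquad\text{for all integers }x\geq R_0\text{ and all }t\in[-T,0],$$ while $u$ is not time analytic.
   Context: On this graph the Laplacian is $\Delta f(x)=f(x+1)+f(x-1)-2f(x)$ for $f:\mathbb Z\to\mathbb R$. A function $u:\mathbb Z\times[-T,0]\to\mathbb R$ is an ancient solution of the heat equation on $\mathbb Z\times[-T,0]$ if $\partial_t u(x,t)=\Delta u(x,t)$ for all $(x,t)\in\mathbb Z\times[-T,0]$, where $\Delta$ acts in $x$ and time derivatives at the endpoints are one-sided. ''$u$ is time analytic'' (on $[-T,0]$) means: for every $x\in\mathbb Z$, $u(x,\cdot)$ is infinitely differentiable on $[-T,0]$ and for every $t_0\in[-T,0]$ there is $r>0$ such that $u(x,t)=\sum_{k=0}^\infty\partial_t^k u(x,t_0)\frac{(t-t_0)^k}{k!}$ (with the series convergent) for all $t\in[-T,0]$ with $|t-t_0|<r$. ''Not time analytic'' is the negation of this. *)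

(* Defs.v *)
From Stdlib Require Import Reals ZArith.
Open Scope R_scope.

(** Functions on [-T, 0] are represented by total functions on [R]; every
    definition below only looks at their values on [-T, 0]. *)
Definition time_interval (T t : R) : Prop := - T <= t <= 0.

(** The Laplacian of the graph on [Z] with [x ~ y] iff [|x - y| = 1], all vertex
    weights and all edge weights being 1. *)
Definition laplacian (f : Z -> R) (x : Z) : R :=
  f (x + 1)%Z + f (x - 1)%Z - 2 * f x.

(** [D_in f g D t] says that the difference quotients [(f s - f t) / (s - t)]
    tend to [g t] as [s] tends to [t] with [s] in [D] and [s <> t]: at the
    endpoints of [D = [-T, 0]] this is the one-sided derivative. *)
Definition ancient_solution (T : R) (u : Z -> R -> R) : Prop :=
  forall (x : Z) (t : R), time_interval T t ->
    D_in (u x) (fun s => laplacian (fun y => u y s) x) (time_interval T) t.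

(** [d k] is the [k]-th derivative of [f] on [-T, 0]; for [0 < T] this determines
    [d k] on [-T, 0]. *)
Definition successive_derivatives (T : R) (f : R -> R) (d : nat -> R -> R) : Prop :=
  (forall t, time_interval T t -> d 0%nat t = f t) /\
  (forall k t, time_interval T t -> D_in (d k) (d (S k)) (time_interval T) t).

Definition time_analytic (T : R) (u : Z -> R -> R) : Prop :=
  forall x : Z, exists d : nat -> R -> R,
    successive_derivatives T (u x) d /\
    forall t0, time_interval T t0 ->
      exists r : R, 0 < r /\
        forall t, time_interval T t -> Rabs (t - t0) < r ->
          infinite_sum (fun k => d k t0 * ((t - t0) ^ k / INR (fact k))) (u x t).

(* Main.v *)
Require Import Defs.
From Stdlib Require Import Reals ZArith.
From Stdlib Require Import Lra Lia.
From Coquelicot Require Import Coquelicot.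
Open Scope R_scope.

(** For [m > 0] the function [m ^ x * exp (l * t)] with [l = m + 1 / m - 2] solves the heat
    equation on [Z].  Superpose these over [m = (n + 1) ^ p], [p = 1 + eps / 2], with
    weights [exp (- n)].  For [t <= 0] the sum is bounded by the sum of
    [exp (- n) (n + 1) ^ (p x)], which is of order [(2 p x) ^ (p x)], while the [k]-th
    time derivative at [x = 0], [t = 0] is at least of order [(k ^ p / (2 e)) ^ k]; since
    [p > 1] this outgrows [k! / r ^ k] for every [r > 0], so the Taylor series at
    [t = 0] has radius of convergence [0]. *)

(** * Series of exponentials at nonpositive times *)

Lemma exp_le (x y : R) : x <= y -> exp x <= exp y.
Proof.
intros [H| ->]; [left; apply exp_increasing, H | apply Rle_refl].
Qed.

(** At nonpositive times [exp (l * s)] and [exp (l * t)] are at most 1, so the remainder is free of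
    exponentials in [l] and can be summed against weights with finite second moment. Only
    [1 + h <= exp h] and [1 - h <= exp (- h)] enter. *)
Lemma exp_Taylor1_bound (l s t : R) : 0 <= l -> s <= 0 -> t <= 0 ->
  Rabs (exp (l * s) - exp (l * t) - l * (s - t) * exp (l * t)) <= (l * (s - t)) ^ 2.
Proof.
intros Hl Hs Ht.
set (h := l * (s - t)).
assert (Es : exp (l * s) = exp (l * t) * exp h).
{ rewrite <- exp_plus; f_equal; unfold h; ring. }
assert (bound1 : forall r, r <= 0 -> exp (l * r) <= 1).
{ intros r Hr. rewrite <- exp_0; apply exp_le; nra. }
pose proof (bound1 s Hs) as Bs; pose proof (bound1 t Ht) as Bt.
pose proof (exp_pos (l * s)) as Ps; pose proof (exp_pos (l * t)) as Pt.
pose proof (exp_ineq1_le h) as H1; pose proof (exp_ineq1_le (- h)) as H2.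
pose proof (exp_pos h) as Ph.
assert (Hinv : exp h * exp (- h) = 1).
{ rewrite <- exp_plus, Rplus_opp_r; apply exp_0. }
rewrite Es, Rabs_pos_eq by nra.
destruct (Rle_lt_dec h 0) as [Hh|Hh].
- assert (exp h - 1 - h <= h ^ 2) by nra.
  nra.
- (* The factor [exp (l * s) <= 1] is pulled out, as [exp h] is unbounded. *)
  replace (exp (l * t) * exp h - exp (l * t) - h * exp (l * t))
    with (exp (l * s) * (1 - (1 + h) * exp (- h))).
  + assert (1 - (1 + h) * exp (- h) <= h ^ 2) by nra.
    nra.
  + rewrite Es.
    replace (exp (l * t) * exp h * (1 - (1 + h) * exp (- h)))
      with (exp (l * t) * (exp h - (1 + h) * (exp h * exp (- h)))) by ring.
    rewrite Hinv; ring.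
Qed.

Lemma Rabs_Series_le (a b : nat -> R) :
  (forall n, Rabs (a n) <= b n) -> ex_series b -> Rabs (Series a) <= Series b.
Proof.
intros Hab Hb.
apply Rle_trans with (Series (fun n => Rabs (a n))).
- apply Series_Rabs.
  apply (ex_series_le (fun n => Rabs (a n)) b); [|exact Hb].
  intros n; change (Rabs (Rabs (a n)) <= b n); rewrite Rabs_Rabsolu; apply Hab.
- apply Series_le; [|exact Hb].
  intros n; split; [apply Rabs_pos | apply Hab].
Qed.

Lemma Series_ge_term (a : nat -> R) (n : nat) :
  (forall k, 0 <= a k) -> ex_series a -> a n <= Series a.
Proof.
intros Ha Hex.
rewrite (Series_incr_n a (S n) (Nat.lt_0_succ n) Hex); simpl Nat.pred.
assert (Htail : 0 <= Series (fun k => a (S n + k)%nat)).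
{ apply Rle_trans with (Rabs (Series (fun _ => 0))); [apply Rabs_pos|].
  apply Rabs_Series_le.
  - intros k; rewrite Rabs_R0; apply Ha.
  - apply (ex_series_incr_n a (S n)); exact Hex. }
assert (Hhead : a n <= sum_f_R0 a n).
{ destruct n as [|n]; simpl; [lra|].
  assert (0 <= sum_f_R0 a n) by (apply cond_pos_sum; exact Ha); lra. }
lra.
Qed.

Lemma ex_series_mul_exp (a l : nat -> R) (t : R) :
  (forall n, 0 <= a n) -> (forall n, 0 <= l n) -> ex_series a -> t <= 0 ->
  ex_series (fun n => a n * exp (l n * t)).
Proof.
intros Ha Hl Hex Ht.
apply (ex_series_le (fun n => a n * exp (l n * t)) a); [|exact Hex].
intros n; change (Rabs (a n * exp (l n * t)) <= a n).
pose proof (exp_pos (l n * t)); pose proof (Ha n); pose proof (Hl n).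
assert (exp (l n * t) <= 1).
{ rewrite <- exp_0; apply exp_le; nra. }
rewrite Rabs_pos_eq; nra.
Qed.

(** Summing the quadratic remainder bound over [n], the linearisation error of the whole series is
    at most [(s - t) ^ 2] times the series of [a n * l n ^ 2]. Divided by [s - t], it tends to 0. *)
Lemma D_in_Series_exp (a l : nat -> R) (T t : R) :
  (forall n, 0 <= a n) -> (forall n, 0 <= l n) ->
  ex_series a -> ex_series (fun n => a n * l n) ->
  ex_series (fun n => a n * l n ^ 2) -> time_interval T t ->
  D_in (fun s => Series (fun n => a n * exp (l n * s)))
       (fun s => Series (fun n => a n * l n * exp (l n * s))) (time_interval T) t.
Proof.
intros Ha Hl H0 H1 H2 [_ Ht] e He.
set (S2 := Series (fun n => a n * l n ^ 2)).
assert (HS2 : 0 <= S2).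
{ apply Rle_trans with (a 0%nat * l 0%nat ^ 2).
  - pose proof (Ha 0%nat); nra.
  - apply (Series_ge_term (fun n => a n * l n ^ 2) 0); [|exact H2].
    intros n; pose proof (Ha n); nra. }
(* The [+ 1] keeps the denominator positive even when [S2 = 0]. *)
exists (e / (S2 + 1)); split; [apply Rdiv_lt_0_compat; lra|].
intros s [[[_ Hs] Hne] Hd]; simpl in Hd |- *; unfold Rdist in *.
assert (Hst : 0 < Rabs (s - t)) by (apply Rabs_pos_lt; lra).
assert (E0 : forall r, r <= 0 -> ex_series (fun n => a n * exp (l n * r))).
{ intros r Hr; apply ex_series_mul_exp; assumption. }
assert (E1 : ex_series (fun n => a n * l n * exp (l n * t))).
{ apply (ex_series_mul_exp (fun n => a n * l n)); auto.
  intros n; apply Rmult_le_pos; auto. }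
assert (E : Series (fun n => a n * exp (l n * s)) - Series (fun n => a n * exp (l n * t))
            - (s - t) * Series (fun n => a n * l n * exp (l n * t))
          = Series (fun n =>
              a n * (exp (l n * s) - exp (l n * t) - l n * (s - t) * exp (l n * t)))).
{ rewrite <- Series_scal_l, <- Series_minus by auto.
  rewrite <- Series_minus.
  - apply Series_ext; intros n; ring.
  - apply (ex_series_minus (fun n => a n * exp (l n * s))); auto.
  - apply (ex_series_scal_l (s - t) (fun n => a n * l n * exp (l n * t))); exact E1. }
assert (B : Rabs (Series (fun n =>
              a n * (exp (l n * s) - exp (l n * t) - l n * (s - t) * exp (l n * t))))
            <= (s - t) ^ 2 * S2).
{ unfold S2; rewrite <- Series_scal_l; apply Rabs_Series_le.
  - intros n; rewrite Rabs_mult, (Rabs_pos_eq (a n)) by auto.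
    replace ((s - t) ^ 2 * (a n * l n ^ 2)) with (a n * (l n * (s - t)) ^ 2) by ring.
    apply Rmult_le_compat_l; auto using exp_Taylor1_bound.
  - apply (ex_series_scal_l ((s - t) ^ 2) (fun n => a n * l n ^ 2)); exact H2. }
rewrite <- E in B.
apply Rmult_lt_reg_l with (Rabs (s - t)); [exact Hst|].
rewrite <- Rabs_mult, Rmult_minus_distr_l.
replace ((s - t) * ((Series (fun n => a n * exp (l n * s)) -
    Series (fun n => a n * exp (l n * t))) / (s - t)))
  with (Series (fun n => a n * exp (l n * s)) - Series (fun n => a n * exp (l n * t)))
  by (field; lra).
apply Rle_lt_trans with (1 := B).
rewrite <- pow2_abs.
replace (Rabs (s - t) ^ 2 * S2) with (Rabs (s - t) * (Rabs (s - t) * S2)) by ring.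
apply Rmult_lt_compat_l; [exact Hst|].
apply Rle_lt_trans with (Rabs (s - t) * (S2 + 1)); [nra|].
apply Rlt_le_trans with (e / (S2 + 1) * (S2 + 1)).
- apply Rmult_lt_compat_r; lra.
- right; field; lra.
Qed.

(** * Uniqueness of derivatives on [[-T, 0]] *)

Lemma D_in_time_interval_unique (T : R) (f g f' g' : R -> R) (t : R) :
  0 < T -> time_interval T t -> (forall s, time_interval T s -> f s = g s) ->
  D_in f f' (time_interval T) t -> D_in g g' (time_interval T) t -> f' t = g' t.
Proof.
intros HT Ht Hfg Hf Hg.
apply (single_limit (fun s => (g s - g t) / (s - t)) (D_x (time_interval T) t) _ _ t).
- intros d Hd; unfold D_x, time_interval, Rdist in *.
  pose proof (Rmin_l (d / 2) (T / 2)); pose proof (Rmin_r (d / 2) (T / 2)).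
  assert (0 < Rmin (d / 2) (T / 2)) by (apply Rmin_glb_lt; lra).
  set (m := Rmin (d / 2) (T / 2)) in *.
  (* Step to the right from the left half and to the left from the right half; [m <= T / 2] keeps
     the new point in the interval. *)
  destruct (Rle_lt_dec t (- T / 2)).
  + exists (t + m); repeat split; try lra.
    replace (t + m - t) with m by ring; rewrite Rabs_pos_eq; lra.
  + exists (t - m); repeat split; try lra.
    replace (t - m - t) with (- m) by ring; rewrite Rabs_Ropp, Rabs_pos_eq; lra.
- intros e He; destruct (Hf e He) as [d [Hd H]].
  exists d; split; [exact Hd|]; intros s Hs.
  rewrite <- (Hfg s), <- (Hfg t) by (try exact Ht; apply Hs).
  apply H; exact Hs.
- exact Hg.
Qed.

(** [time_analytic] only provides some family [d]; this identifies it with the explicit derivatives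
    of the superposition. *)
Lemma successive_derivatives_unique (T : R) (f : R -> R) (d e : nat -> R -> R) :
  0 < T -> successive_derivatives T f d -> successive_derivatives T f e ->
  forall k t, time_interval T t -> d k t = e k t.
Proof.
intros HT [d0 dS] [e0 eS] k; induction k as [|k IH]; intros t Ht.
- rewrite d0, e0; auto.
- exact (D_in_time_interval_unique T (d k) (e k) (d (S k)) (e (S k)) t HT Ht IH
           (dS k t Ht) (eS k t Ht)).
Qed.

(** * The superposed solution, its derivatives and its growth *)

(** The frequencies [m = (n + 1) ^ p] are handled through their logarithms. *)
Definition log_freq (p : R) (n : nat) : R := p * ln (INR n + 1).

Definition eigenvalue (p : R) (n : nat) : R :=
  exp (log_freq p n) + exp (- log_freq p n) - 2.

(** [superposition p k x t] is the [k]-th time derivative of the solution at [(x, t)]. *)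
Definition superposition (p : R) (k : nat) (x t : R) : R :=
  Series (fun n => exp (- INR n + x * log_freq p n) * eigenvalue p n ^ k
                   * exp (eigenvalue p n * t)).

Lemma ln_INR_succ_nonneg (n : nat) : 0 <= ln (INR n + 1).
Proof.
rewrite <- ln_1; apply ln_le; [lra|]; pose proof (pos_INR n); lra.
Qed.

(** The lower bound is [m + 1 / m >= 2], and makes the time factors at most 1 for [t <= 0]. The
    upper bound lets [k] time derivatives cost no more than a shift of [x] by [k]. *)
Lemma eigenvalue_bounds (p : R) (n : nat) :
  0 <= p -> 0 <= eigenvalue p n <= exp (log_freq p n).
Proof.
intros Hp; unfold eigenvalue.
assert (HL : 0 <= log_freq p n).
{ apply Rmult_le_pos; [exact Hp | apply ln_INR_succ_nonneg]. }
set (L := log_freq p n) in *.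
pose proof (exp_pos L); pose proof (exp_pos (- L)).
assert (exp L * exp (- L) = 1) by (rewrite <- exp_plus, Rplus_opp_r; apply exp_0).
assert (exp (- L) <= 1) by (rewrite <- exp_0; apply exp_le; lra).
split; [|lra].
pose proof (pow2_ge_0 (exp L - exp (- L))).
pose proof (pow2_ge_0 (exp L + exp (- L) - 2)); nra.
Qed.

Lemma exp_pow_INR (a : R) (n : nat) : exp a ^ n = exp (INR n * a).
Proof.
induction n as [|n IH].
- simpl; rewrite Rmult_0_l, exp_0; reflexivity.
- rewrite S_INR; simpl; rewrite IH, <- exp_plus; f_equal; ring.
Qed.

(** This is [exp ((1 - n) / 2)]: what is left of [exp (- n)] once half of the decay has absorbed a
    power of [n + 1]. *)
Definition geometric_bound (n : nat) : R := exp (/ 2) * exp (- / 2) ^ n.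

Lemma ex_series_geometric_bound : ex_series geometric_bound.
Proof.
apply (ex_series_scal_l (exp (/ 2)) (fun n => exp (- / 2) ^ n)).
apply ex_series_geom.
rewrite Rabs_pos_eq by (left; apply exp_pos).
rewrite <- exp_0; apply exp_increasing; lra.
Qed.

Lemma geometric_bound_pos (n : nat) : 0 < geometric_bound n.
Proof.
apply Rmult_lt_0_compat; [|apply pow_lt]; apply exp_pos.
Qed.

(** Compare [ln ((n + 1) / (2 y))] with [(n + 1) / (2 y) - 1]. *)
Lemma weight_bound (y : R) (n : nat) : 0 < y ->
  exp (- INR n + y * ln (INR n + 1)) <= exp (y * ln (2 * y)) * geometric_bound n.
Proof.
intros Hy; unfold geometric_bound.
rewrite exp_pow_INR, <- !exp_plus.
apply exp_le.
pose proof (pos_INR n) as Hn.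
set (z := (INR n + 1) / (2 * y)).
assert (Hz : 0 < z) by (apply Rdiv_lt_0_compat; lra).
assert (Ez : INR n + 1 = 2 * y * z) by (unfold z; field; lra).
assert (Hl : ln z <= z - 1).
{ pose proof (exp_ineq1_le (ln z)) as H; rewrite exp_ln in H; lra. }
rewrite Ez, ln_mult by lra.
assert (y * ln z <= y * (z - 1)) by (apply Rmult_le_compat_l; lra).
lra.
Qed.

Lemma ex_series_weight (p x : R) (k : nat) : 1 <= p ->
  ex_series (fun n => exp (- INR n + x * log_freq p n) * eigenvalue p n ^ k).
Proof.
intros Hp.
pose proof (pos_INR k) as Hk; pose proof (Rabs_pos x) as Hx; pose proof (Rle_abs x) as Hx'.
(* The exponent of [n + 1] is at most [(x + k) * p]. The absolute value and the [+ 1] make [y]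
   positive for every [x] and [k], as [weight_bound] requires. *)
set (y := (Rabs x + INR k + 1) * p).
assert (Hy : 0 < y) by (apply Rmult_lt_0_compat; lra).
apply (ex_series_le (fun n => exp (- INR n + x * log_freq p n) * eigenvalue p n ^ k)
         (fun n => exp (y * ln (2 * y)) * geometric_bound n)).
- intros n.
  change (Rabs (exp (- INR n + x * log_freq p n) * eigenvalue p n ^ k)
          <= exp (y * ln (2 * y)) * geometric_bound n).
  destruct (eigenvalue_bounds p n) as [H0 H1]; [lra|].
  pose proof (ln_INR_succ_nonneg n) as Hln.
  rewrite Rabs_pos_eq
    by (apply Rmult_le_pos; [left; apply exp_pos | apply pow_le, H0]).
  apply Rle_trans with (2 := weight_bound y n Hy).
  apply Rle_trans with (exp (- INR n + x * log_freq p n) * exp (log_freq p n) ^ k).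
  + apply Rmult_le_compat_l; [left; apply exp_pos|].
    apply pow_incr; split; assumption.
  + rewrite exp_pow_INR, <- exp_plus; apply exp_le.
    unfold y, log_freq.
    assert (0 <= p * ln (INR n + 1)) by (apply Rmult_le_pos; lra).
    nra.
- apply (ex_series_scal_l (exp (y * ln (2 * y))) geometric_bound).
  exact ex_series_geometric_bound.
Qed.

Lemma weight_nonneg (p x : R) (k n : nat) : 1 <= p ->
  0 <= exp (- INR n + x * log_freq p n) * eigenvalue p n ^ k.
Proof.
intros Hp; apply Rmult_le_pos; [left; apply exp_pos|].
apply pow_le, eigenvalue_bounds; lra.
Qed.

Lemma ex_series_superposition (p : R) (k : nat) (x t : R) : 1 <= p -> t <= 0 ->
  ex_series (fun n => exp (- INR n + x * log_freq p n) * eigenvalue p n ^ k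
                      * exp (eigenvalue p n * t)).
Proof.
intros Hp Ht.
apply (ex_series_mul_exp
         (fun n => exp (- INR n + x * log_freq p n) * eigenvalue p n ^ k) (eigenvalue p)).
- intros n; apply weight_nonneg, Hp.
- intros n; apply eigenvalue_bounds; lra.
- apply ex_series_weight, Hp.
- exact Ht.
Qed.

Lemma D_in_superposition (p T : R) (k : nat) (x t : R) : 1 <= p -> time_interval T t ->
  D_in (superposition p k x) (superposition p (S k) x) (time_interval T) t.
Proof.
intros Hp Ht.
pose (a := fun n => exp (- INR n + x * log_freq p n) * eigenvalue p n ^ k).
assert (E : superposition p (S k) x t
            = Series (fun n => a n * eigenvalue p n * exp (eigenvalue p n * t))).
{ apply Series_ext; intros n; unfold a; simpl; ring. }
(* [D_in] sees the derivative only through its value at [t], so an equation at that point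
   suffices. *)
unfold D_in; rewrite E.
apply (D_in_Series_exp a (eigenvalue p) T t).
- intros n; apply weight_nonneg, Hp.
- intros n; apply eigenvalue_bounds; lra.
- apply ex_series_weight, Hp.
- apply ex_series_ext with (2 := ex_series_weight p x (S k) Hp).
  intros n; unfold a; simpl; ring.
- apply ex_series_ext with (2 := ex_series_weight p x (S (S k)) Hp).
  intros n; unfold a; simpl; ring.
- exact Ht.
Qed.

(** Shifting [x] by one multiplies the [n]-th term by [exp (log_freq p n)] or its inverse, so the
    Laplacian acts on each term as multiplication by its eigenvalue. *)
Lemma laplacian_superposition (p : R) (x : Z) (t : R) : 1 <= p -> t <= 0 ->
  laplacian (fun y => superposition p 0 (IZR y) t) x = superposition p 1 (IZR x) t.
Proof.
intros Hp Ht; unfold laplacian, superposition.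
pose proof (fun y => ex_series_superposition p 0 y t Hp Ht) as H.
rewrite <- Series_scal_l, <- Series_plus, <- Series_minus.
- apply Series_ext; intros n.
  rewrite plus_IZR, minus_IZR.
  replace (- INR n + (IZR x + 1) * log_freq p n)
    with (- INR n + IZR x * log_freq p n + log_freq p n) by ring.
  replace (- INR n + (IZR x - 1) * log_freq p n)
    with (- INR n + IZR x * log_freq p n + - log_freq p n) by ring.
  rewrite (exp_plus _ (log_freq p n)), (exp_plus _ (- log_freq p n)).
  (* Hiding the time factor keeps [unfold] from expanding the eigenvalue inside the exponent. *)
  generalize (exp (eigenvalue p n * t)); intros e; unfold eigenvalue; ring.
- exact (ex_series_plus _ _ (H (IZR (x + 1))) (H (IZR (x - 1)))).
- exact (ex_series_scal_l 2 _ (H (IZR x))).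
- apply H.
- apply H.
Qed.

Lemma Rabs_superposition_le (p x t : R) : 1 <= p -> 0 < x -> t <= 0 ->
  Rabs (superposition p 0 x t) <= Series geometric_bound * exp (p * x * ln (2 * (p * x))).
Proof.
intros Hp Hx Ht.
rewrite Rmult_comm, <- Series_scal_l.
apply Rabs_Series_le.
- intros n.
  assert (Hy : 0 < p * x) by (apply Rmult_lt_0_compat; lra).
  apply Rle_trans with (2 := weight_bound (p * x) n Hy).
  replace (p * x * ln (INR n + 1)) with (x * log_freq p n) by (unfold log_freq; ring).
  destruct (eigenvalue_bounds p n) as [H0 _]; [lra|].
  assert (exp (eigenvalue p n * t) <= 1) by (rewrite <- exp_0; apply exp_le; nra).
  pose proof (exp_pos (eigenvalue p n * t)).
  pose proof (exp_pos (- INR n + x * log_freq p n)).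
  simpl; rewrite Rabs_pos_eq; nra.
- apply (ex_series_scal_l _ geometric_bound), ex_series_geometric_bound.
Qed.

(** * Divergence of the Taylor series at the origin *)

Lemma fact_le_pow (n : nat) : INR (fact n) <= (INR n + 1) ^ n.
Proof.
induction n as [|n IH]; [simpl; lra|].
rewrite fact_simpl, mult_INR, S_INR.
pose proof (pos_INR n).
simpl pow; apply Rmult_le_compat; try lra; [apply pos_INR|].
apply Rle_trans with (1 := IH), pow_incr; lra.
Qed.

(** All terms of the series are nonnegative, so keep only the one of index [n]. It is at least
    [((n + 1) ^ p / (2 * e)) ^ n], with [e] Euler's number; against [n! <= (n + 1) ^ n] this leaves
    [((n + 1) ^ (p - 1) * s / (2 * e)) ^ n], whose base eventually exceeds 1. *)
Lemma superposition_Taylor_term_large (p s : R) : 1 < p -> 0 < s ->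
  exists N, forall n, (N <= n)%nat ->
    1 <= superposition p n 0 0 * (s ^ n / INR (fact n)).
Proof.
intros Hp Hs.
(* [M] solves [M ^ (p - 1) * s = 2 * e]. The extra 3 below gives [n + 1 >= 4], so that the [- 2] in
   the eigenvalue costs at most a factor 2. *)
set (M := exp ((1 + ln 2 - ln s) / (p - 1))).
destruct (INR_unbounded (M + 3)) as [N HN].
exists N; intros n Hn.
assert (HM : 0 < M) by apply exp_pos.
assert (HnN : M + 3 < INR n) by (apply le_INR in Hn; lra).
assert (Hterm : exp (- INR n) * eigenvalue p n ^ n <= superposition p n 0 0).
{ pose proof (Series_ge_term
    (fun m => exp (- INR m + 0 * log_freq p m) * eigenvalue p m ^ n
              * exp (eigenvalue p m * 0)) n) as H.
  simpl in H; rewrite Rmult_0_l, Rplus_0_r, Rmult_0_r, exp_0, Rmult_1_r in H.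
  apply H.
  - intros m; apply Rmult_le_pos; [|left; apply exp_pos].
    apply weight_nonneg; lra.
  - apply ex_series_superposition; lra. }
assert (Hl : 0 <= ln (INR n + 1)) by apply ln_INR_succ_nonneg.
assert (Heig : exp (log_freq p n - ln 2) <= eigenvalue p n).
{ unfold Rminus; rewrite exp_plus, exp_Ropp, exp_ln by lra.
  unfold eigenvalue.
  assert (exp (ln (INR n + 1)) <= exp (log_freq p n))
    by (apply exp_le; unfold log_freq; nra).
  rewrite exp_ln in H by lra.
  pose proof (exp_pos (- log_freq p n)); lra. }
assert (Hpow : exp (INR n * (log_freq p n - ln 2)) <= eigenvalue p n ^ n).
{ rewrite <- exp_pow_INR; apply pow_incr; split; [left; apply exp_pos | exact Heig]. }
assert (Hfact : INR (fact n) <= exp (INR n * ln (INR n + 1))).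
{ rewrite <- exp_pow_INR, exp_ln by lra; apply fact_le_pow. }
assert (Hln : (1 + ln 2 - ln s) <= (p - 1) * ln (INR n + 1)).
{ apply Rmult_le_reg_l with (/ (p - 1)); [apply Rinv_0_lt_compat; lra|].
  replace (/ (p - 1) * ((p - 1) * ln (INR n + 1))) with (ln (INR n + 1)) by (field; lra).
  replace (/ (p - 1) * (1 + ln 2 - ln s)) with (ln M)
    by (unfold M; rewrite ln_exp; field; lra).
  apply ln_le; lra. }
pose proof (INR_fact_lt_0 n) as Hf.
apply Rmult_le_reg_r with (INR (fact n)); [exact Hf|].
replace (superposition p n 0 0 * (s ^ n / INR (fact n)) * INR (fact n))
  with (superposition p n 0 0 * s ^ n) by (field; lra).
rewrite Rmult_1_l.
apply Rle_trans with (1 := Hfact).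
apply Rle_trans with (exp (- INR n) * exp (INR n * (log_freq p n - ln 2)) * s ^ n).
- rewrite <- (exp_ln s Hs) at 1; rewrite exp_pow_INR, <- !exp_plus.
  apply exp_le; unfold log_freq; nra.
- apply Rmult_le_compat_r; [left; apply pow_lt, Hs|].
  apply Rle_trans with (2 := Hterm).
  apply Rmult_le_compat_l; [left; apply exp_pos | exact Hpow].
Qed.

Theorem proposition3p1 (T : R) (hT : 0 < T) (eps : R) (heps : 0 < eps) :
  exists (R0 A : R) (u : Z -> R -> R),
    0 < R0 /\ 0 < A /\
    ancient_solution T u /\
    (forall (x : Z) (t : R), R0 <= IZR x -> - T <= t <= 0 ->
       Rabs (u x t) <= A * exp ((1 + eps) * IZR x * ln (IZR x))) /\
    ~ time_analytic T u.
Proof.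
(* Any [p > 1] destroys analyticity; staying below [1 + eps] leaves [eps / 2] in the exponent to
   absorb the factor [(2 * p) ^ (p * x)], which happens once [x >= R0]. *)
set (p := 1 + eps / 2).
assert (Hp : 1 < p) by (unfold p; lra).
set (R0 := exp (2 * (p * ln (2 * p)) / eps)).
exists R0, (Series geometric_bound), (fun x => superposition p 0 (IZR x)).
assert (HA : 0 < Series geometric_bound).
{ apply Rlt_le_trans with (1 := geometric_bound_pos 0).
  apply Series_ge_term; [|exact ex_series_geometric_bound].
  intros n; left; apply geometric_bound_pos. }
assert (HR0 : 0 < R0) by apply exp_pos.
split; [exact HR0|]; split; [exact HA|]; repeat split.
- intros x t Ht.
  unfold D_in; rewrite laplacian_superposition; [|lra|apply Ht].
  apply D_in_superposition; [lra | exact Ht].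
- intros x t Hx Ht.
  apply Rle_trans with (1 := Rabs_superposition_le p (IZR x) t ltac:(lra) ltac:(lra)
                               (proj2 Ht)).
  apply Rmult_le_compat_l; [lra|]; apply exp_le.
  assert (Hln : p * ln (2 * p) <= eps / 2 * ln (IZR x)).
  { apply Rle_trans with (eps / 2 * ln R0).
    - unfold R0; rewrite ln_exp; right; field; lra.
    - apply Rmult_le_compat_l; [lra|]; apply ln_le; lra. }
  replace (2 * (p * IZR x)) with (2 * p * IZR x) by ring.
  rewrite ln_mult by lra.
  apply (Rmult_le_compat_l (IZR x)) in Hln; [|lra].
  replace ((1 + eps) * IZR x * ln (IZR x))
    with (p * IZR x * ln (IZR x) + IZR x * (eps / 2 * ln (IZR x)))
    by (unfold p; field).
  lra.
- intros Han; destruct (Han 0%Z) as [d [Hd Hser]].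
  assert (Ht0 : time_interval T 0) by (unfold time_interval; lra).
  assert (Hd0 : forall k, d k 0 = superposition p k 0 0).
  { intros k.
    apply (successive_derivatives_unique T (superposition p 0 0) d
             (fun k => superposition p k 0)); auto.
    split; [reflexivity|].
    intros j t Ht; apply D_in_superposition; [lra | exact Ht]. }
  destruct (Hser 0 Ht0) as [r [Hr Hsum]].
  (* The series is tested at time [- s]: the minimum with [T] keeps it in the interval, and halving
     [r] makes [s < r] strict. *)
  set (s := Rmin (r / 2) T).
  assert (Hs : 0 < s) by (apply Rmin_glb_lt; lra).
  assert (Hsr : s <= r / 2) by apply Rmin_l.
  assert (HsT : s <= T) by apply Rmin_r.
  (* Convergence forces the terms to 0. At [- s] they alternate in sign, but in absolute value they
     are those at [s], eventually at least 1. *)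
  assert (Hlim : is_lim_seq (fun k => d k 0 * ((- s - 0) ^ k / INR (fact k))) 0).
  { apply ex_series_lim_0; eexists.
    apply is_series_Reals, Hsum.
    - unfold time_interval; lra.
    - rewrite Rminus_0_r, Rabs_Ropp, Rabs_pos_eq; lra. }
  apply is_lim_seq_spec in Hlim.
  destruct (Hlim (mkposreal 1 Rlt_0_1)) as [N1 HN1].
  destruct (superposition_Taylor_term_large p s Hp Hs) as [N2 HN2].
  specialize (HN1 (N1 + N2)%nat (Nat.le_add_r _ _)).
  specialize (HN2 (N1 + N2)%nat ltac:(lia)).
  set (n := (N1 + N2)%nat) in *; simpl in HN1.
  rewrite Hd0, !Rminus_0_r in HN1.
  pose proof (Rle_abs (superposition p n 0 0)) as Habs.
  pose proof (INR_fact_lt_0 n) as Hf.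
  unfold Rdiv in HN1, HN2.
  rewrite !Rabs_mult, <- RPow_abs, Rabs_Ropp, (Rabs_pos_eq s) in HN1 by lra.
  rewrite (Rabs_pos_eq (/ INR (fact n))) in HN1
    by (left; apply Rinv_0_lt_compat, Hf).
  assert (0 < s ^ n * / INR (fact n))
    by (apply Rmult_lt_0_compat; [apply pow_lt, Hs | apply Rinv_0_lt_compat, Hf]).
  nra.
Qed.
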